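(* Let $\mathbb{F}_q$ be a finite field of odd characteristic and let $\epsilon,\delta\in\mathbb{F}_q$ with $\epsilon(\delta^2-\epsilon)\neq0$ and $\delta\neq 0$. Let $w$ be the function on the Jacobi quartic curve $J_{\epsilon,\delta}: y^2=\epsilon x^4+2\delta x^2+1$ over $\mathbb{F}_q$ given by $w(x,y)=2\delta x^2/y^2$. Let $P_1,P_2$ be two points of $J_{\epsilon,\delta}(\mathbb{F}_q)$ and write $w_0=w(P_2-P_1)$, $w_1=w(P_1)$, $w_2=w(P_2)$, $w_3=w(P_1+P_2)$, $w_4=w(2P_1)$. If $w_i\in\mathbb{F}_q$ for $i=0,1,2,3,4$ (i.e. $w$ has a finite value at each of these points), $w_1w_2\neq \delta^2/(\delta^2-\epsilon)$ and $w_1^2\neq \delta^2/(\delta^2-\epsilon)$, then $$w_4=\frac{4w_1\left((w_1-1)^2-\frac{\epsilon}{\delta^2}w_1^2\right)}{\left(\left(1-\frac{\epsilon}{\delta^2}\right)w_1^2-1\right)^2},\qquad w_3w_0=\frac{(w_1-w_2)^2}{\left(\left(1-\frac{\epsilon}{\delta^2}\right)w_1w_2-1\right)^2}.$$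
   Context: The Jacobi quartic curve $J_{\epsilon,\delta}$ is regarded as an elliptic curve through its smooth projective model $X^2=TZ$, $Y^2=\epsilon T^2+2\delta X^2+Z^2$ in $\mathbb{P}^3$ with coordinates $(X:Y:T:Z)$, the affine point $(x,y)$ being $(x:y:x^2:1)$; the points with $Z=0$ are $(0:\pm\sqrt{\epsilon}:1:0)$ ($\mathbb{F}_q$-rational exactly when $\epsilon$ is a square). The identity is $(0,1)$, $-(x,y)=(-x,y)$, and addition is generically $$(x_1,y_1)+(x_2,y_2)=\left(\frac{x_1y_2+x_2y_1}{1-\epsilon x_1^2x_2^2},\ \frac{(y_1y_2+2\delta x_1x_2)(1+\epsilon x_1^2x_2^2)+2\epsilon x_1x_2(x_1^2+x_2^2)}{(1-\epsilon x_1^2x_2^2)^2}\right).$$ *)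

(* Defs.v *)
From HB Require Import structures.
From mathcomp Require Import all_boot all_order all_algebra.
From mathcomp Require Import ring.

Set Implicit Arguments.
Unset Strict Implicit.
Unset Printing Implicit Defensive.

Import GRing.Theory.
Local Open Scope ring_scope.

(* The Jacobi quartic y^2 = e x^4 + 2 d x^2 + 1, through its smooth model in
   P^3; a 4-tuple (X, Y, T, Z) stands for homogeneous coordinates (X:Y:T:Z). *)

Section JacobiQuartic.

Variables (F : fieldType) (e d : F).

Implicit Types u v : F * F * F * F.

Definition on_jquartic v : bool :=
  let: (X, Y, T, Z) := v in
  (X ^+ 2 == T * Z) && (Y ^+ 2 == e * T ^+ 2 + 2%:R * d * X ^+ 2 + Z ^+ 2).

(* T = Z = 0 forces X = Y = 0 on the curve, so a point has exactly one
   representative with Z = 1, or with Z = 0 and T = 1. *)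
Definition jq_reduced v : bool :=
  let: (X, Y, T, Z) := v in (Z == 1) || (Z == 0) && (T == 1).

Definition jq_reduce v : F * F * F * F :=
  let: (X, Y, T, Z) := v in
  let c := if Z != 0 then Z else T in (X / c, Y / c, T / c, Z / c).

(* The rational points of the projective model, both affine and at infinity. *)
Record jqpoint := JQPoint {
  jqcoords :> F * F * F * F;
  _ : on_jquartic jqcoords && jq_reduced jqcoords
}.

HB.instance Definition _ := [isSub for jqcoords].
HB.instance Definition _ := [Equality of jqpoint by <:].

Fact jq0_subproof : on_jquartic (0, 1, 0, 1) && jq_reduced (0, 1, 0, 1).
Proof.
by rewrite /= eqxx !(mul0r, mulr0, expr0n, expr1n, add0r, eqxx).
Qed.

Definition jq0 : jqpoint := JQPoint jq0_subproof.

Definition jq_opp_coords v : F * F * F * F :=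
  let: (X, Y, T, Z) := v in (- X, Y, T, Z).

Fact jq_opp_subproof (P : jqpoint) :
  on_jquartic (jq_opp_coords P) && jq_reduced (jq_opp_coords P).
Proof. by case: P => [[[[X Y] T] Z] /=]; rewrite sqrrN. Qed.

Definition jq_opp (P : jqpoint) : jqpoint := JQPoint (jq_opp_subproof P).

(* Homogenisation of
     x3 = (x1 y2 + x2 y1) / (1 - e x1^2 x2^2)
     y3 = ((y1 y2 + 2 d x1 x2) (1 + e x1^2 x2^2) + 2 e x1 x2 (x1^2 + x2^2))
          / (1 - e x1^2 x2^2)^2,
   using x^2 = T / Z.  It is the null vector exactly when the two points differ
   by a point at infinity. *)
Definition jq_law1 u v : F * F * F * F :=
  let: (X1, Y1, T1, Z1) := u in
  let: (X2, Y2, T2, Z2) := v in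
  let N := X1 * Y2 + X2 * Y1 in
  let D := Z1 * Z2 - e * T1 * T2 in
  (N * D,
   (Y1 * Y2 + 2%:R * d * X1 * X2) * (Z1 * Z2 + e * T1 * T2)
     + 2%:R * e * X1 * X2 * (T1 * Z2 + T2 * Z1),
   N ^+ 2,
   D ^+ 2).

(* The same rational map, in the form
     x3 = (x1^2 - x2^2) / (x1 y2 - x2 y1)
     y3 = ((x1^2 + x2^2) (y1 y2 - 2 d x1 x2) - 2 x1 x2 (1 + e x1^2 x2^2))
          / (x1 y2 - x2 y1)^2;
   it is the null vector exactly when the two points differ by (0, 1) or
   (0, -1), so that one of the two forms always applies: see
   [jq_laws_complete] and [jq_laws_agree]. *)
Definition jq_law2 u v : F * F * F * F :=
  let: (X1, Y1, T1, Z1) := u in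
  let: (X2, Y2, T2, Z2) := v in
  let A := T1 * Z2 - T2 * Z1 in
  let B := X1 * Y2 - X2 * Y1 in
  (A * B,
   (T1 * Z2 + T2 * Z1) * (Y1 * Y2 - 2%:R * d * X1 * X2)
     - 2%:R * X1 * X2 * (Z1 * Z2 + e * T1 * T2),
   A ^+ 2,
   B ^+ 2).

Definition jq_add_coords u v : F * F * F * F :=
  if jq_law1 u v != (0, 0, 0, 0) then jq_law1 u v else jq_law2 u v.

(* The default value [jq0] of [insubd] is never used on a nonsingular curve in
   characteristic different from 2: see [jqcoords_add]. *)
Definition jq_add (P Q : jqpoint) : jqpoint :=
  insubd jq0 (jq_reduce (jq_add_coords P Q)).

Definition jq_sub (P Q : jqpoint) : jqpoint := jq_add P (jq_opp Q).

Definition jq_double (P : jqpoint) : jqpoint := jq_add P P.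

(* The value in P^1(F) of w = 2 d x^2 / y^2 = 2 d X^2 / Y^2, with [None] for
   infinity; X and Y have no common zero on the curve.  In particular w
   vanishes at the points at infinity. *)
Definition jq_w (P : jqpoint) : option F :=
  let: (X, Y, T, Z) := jqcoords P in
  if Y == 0 then None else Some (2%:R * d * X ^+ 2 / Y ^+ 2).

Lemma jq_law1_on u v :
  on_jquartic u -> on_jquartic v -> on_jquartic (jq_law1 u v).
Proof.
case: u v => [[[X1 Y1] T1] Z1] [[[X2 Y2] T2] Z2] /=.
move=> /andP[/eqP hX1 /eqP hY1] /andP[/eqP hX2 /eqP hY2].
apply/andP; split; apply/eqP; first by ring.
by ring: hX1 hY1 hX2 hY2.
Qed.

Lemma jq_law2_on u v :
  on_jquartic u -> on_jquartic v -> on_jquartic (jq_law2 u v).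
Proof.
case: u v => [[[X1 Y1] T1] Z1] [[[X2 Y2] T2] Z2] /=.
move=> /andP[/eqP hX1 /eqP hY1] /andP[/eqP hX2 /eqP hY2].
apply/andP; split; apply/eqP; first by ring.
by ring: hX1 hY1 hX2 hY2.
Qed.

(* The two vectors are proportional: all their 2 x 2 minors vanish. *)
Lemma jq_laws_agree u v : on_jquartic u -> on_jquartic v ->
  let: (X3, Y3, T3, Z3) := jq_law1 u v in
  let: (X4, Y4, T4, Z4) := jq_law2 u v in
  [/\ X3 * Y4 = X4 * Y3, X3 * T4 = X4 * T3, X3 * Z4 = X4 * Z3
    & [/\ Y3 * T4 = Y4 * T3, Y3 * Z4 = Y4 * Z3 & T3 * Z4 = T4 * Z3]].
Proof.
case: u v => [[[X1 Y1] T1] Z1] [[[X2 Y2] T2] Z2] /=.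
move=> /andP[/eqP hX1 /eqP hY1] /andP[/eqP hX2 /eqP hY2].
by split; [ring: hX1 hY1 hX2 hY2..|split; ring: hX1 hY1 hX2 hY2].
Qed.

Lemma jq_reduced_shape (P : jqpoint) :
  (exists x y, jqcoords P = (x, y, x ^+ 2, 1)) \/
  (exists s, s ^+ 2 = e /\ jqcoords P = (0, s, 1, 0)).
Proof.
case: P => [[[[X Y] T] Z] /= /andP[/andP[/eqP hX /eqP hY]]].
case/orP=> [/eqP Z1|/andP[/eqP Z0 /eqP T1]].
  by left; exists X, Y; rewrite hX Z1 mulr1.
have X0 : X = 0 by apply/eqP; rewrite -sqrf_eq0 hX Z0 mulr0.
right; exists Y; split; last by rewrite X0 T1 Z0.
by rewrite hY X0 T1 Z0; ring.
Qed.

Hypothesis char_neq2 : 2%N \notin [pchar F].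
Hypothesis nonsing : e * (d ^+ 2 - e) != 0.

Let two_neq0 : 2%:R != 0 :> F.
Proof. by move: char_neq2; rewrite inE. Qed.

Let e_neq0 : e != 0.
Proof. by apply: contraNneq nonsing => ->; rewrite mul0r. Qed.

Lemma jq_laws_complete (P Q : jqpoint) :
  jq_law1 P Q = (0, 0, 0, 0) -> jq_law2 P Q <> (0, 0, 0, 0).
Proof.
have := valP P; have := valP Q => /= /andP[onQ _] /andP[onP _].
have [[x1 [y1 EP]]|[s1 [s1e EP]]] := jq_reduced_shape P;
have [[x2 [y2 EQ]]|[s2 [s2e EQ]]] := jq_reduced_shape Q;
move: onP onQ; rewrite EP EQ /= => onP onQ.
- case=> _ _ /eqP; rewrite sqrf_eq0 => /eqP N0 /eqP; rewrite sqrf_eq0 => /eqP D0.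
  case=> _ _ /eqP; rewrite sqrf_eq0 => /eqP A0 /eqP; rewrite sqrf_eq0 => /eqP B0.
  have x12 : e * x1 ^+ 2 * x2 ^+ 2 = 1 by apply/esym/subr0_eq; rewrite -[RHS]D0; ring.
  have x1n0 : x1 != 0.
    by apply: contra_eq_neq x12 => ->; rewrite expr0n /= mulr0 mul0r eq_sym oner_eq0.
  have y2_0 : y2 = 0.
    have : 2%:R * x1 * y2 = 0 by rewrite -[RHS](addr0 0) -{1}N0 -B0; ring.
    by move/eqP; rewrite !mulf_eq0 (negPf two_neq0) (negPf x1n0) => /eqP.
  have x2sq : x2 ^+ 2 = x1 ^+ 2 by apply/esym/subr0_eq; rewrite -[RHS]A0; ring.
  move: onQ => /andP[_ /eqP]; rewrite y2_0 x2sq => hy.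
  rewrite x2sq in x12.
  have dx : d * x1 ^+ 2 = - 1.
    apply: (mulfI two_neq0); apply/subr0_eq.
    transitivity (e * (x1 ^+ 2) ^+ 2 + 2%:R * d * x1 ^+ 2 + 1 ^+ 2
                  - (e * x1 ^+ 2 * x1 ^+ 2 - 1)); first by ring.
    by rewrite -hy x12; ring.
  move: nonsing; rewrite mulf_eq0 negb_or => /andP[_ /eqP]; apply.
  have : (d ^+ 2 - e) * (x1 ^+ 2) ^+ 2 = 0.
    transitivity ((d * x1 ^+ 2) ^+ 2 - e * x1 ^+ 2 * x1 ^+ 2); first by ring.
    by rewrite dx x12; ring.
  by move/eqP; rewrite mulf_eq0 !sqrf_eq0 (negPf x1n0) orbF => /eqP.
- move=> _ [_ _ + _] => /eqP; rewrite sqrf_eq0 mulr0 mul1r sub0r oppr_eq0.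
  by rewrite oner_eq0.
- move=> _ [_ _ + _] => /eqP; rewrite sqrf_eq0 mulr0 mul1r subr0.
  by rewrite oner_eq0.
- move=> [_ _ _ /eqP]; rewrite sqrf_eq0 mulr0 !mulr1 sub0r oppr_eq0.
  by rewrite (negPf e_neq0).
Qed.

Lemma jq_reduceP v : on_jquartic v -> v != (0, 0, 0, 0) ->
  on_jquartic (jq_reduce v) && jq_reduced (jq_reduce v).
Proof.
case: v => [[[X Y] T] Z] /= /andP[/eqP hX /eqP hY] vn0.
set c := if _ then _ else _.
have cn0 : c != 0.
  rewrite /c; case: ifPn => // /negbNE /eqP Z0.
  apply: contraNneq vn0 => T0; move: hX; rewrite T0 mul0r => /eqP.
  rewrite sqrf_eq0 => /eqP X0; move: hY; rewrite Z0 T0 X0 !expr0n /= !mulr0 !addr0.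
  by move/eqP; rewrite sqrf_eq0 => /eqP ->.
apply/andP; split.
  rewrite !expr_div_n hY hX; apply/andP; split; apply/eqP; field; exact: cn0.
rewrite /c; case: ifPn => [Zn0|/negbNE /eqP Z0]; first by rewrite divff ?eqxx.
by move: cn0; rewrite /c Z0 eqxx /= mul0r eqxx => ?; rewrite divff ?eqxx ?orbT.
Qed.

Lemma jqcoords_add (P Q : jqpoint) :
  jqcoords (jq_add P Q) = jq_reduce (jq_add_coords P Q).
Proof.
have := valP P; have := valP Q => /= /andP[onQ _] /andP[onP _].
rewrite /jq_add -[jqcoords _]/(val _) insubdK // unfold_in.
rewrite /jq_add_coords; case: ifPn => [n0|/negbNE /eqP z].
  by apply: jq_reduceP n0; exact: jq_law1_on.
by apply: jq_reduceP; [exact: jq_law2_on|exact/eqP/jq_laws_complete].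
Qed.

Lemma jq_add_affine (P Q : jqpoint) x1 y1 x2 y2 :
  jqcoords P = (x1, y1, x1 ^+ 2, 1) -> jqcoords Q = (x2, y2, x2 ^+ 2, 1) ->
  1 - e * x1 ^+ 2 * x2 ^+ 2 != 0 ->
  let x3 := (x1 * y2 + x2 * y1) / (1 - e * x1 ^+ 2 * x2 ^+ 2) in
  let y3 := ((y1 * y2 + 2%:R * d * x1 * x2) * (1 + e * x1 ^+ 2 * x2 ^+ 2)
             + 2%:R * e * x1 * x2 * (x1 ^+ 2 + x2 ^+ 2))
            / (1 - e * x1 ^+ 2 * x2 ^+ 2) ^+ 2 in
  jqcoords (jq_add P Q) = (x3, y3, x3 ^+ 2, 1).
Proof.
move=> EP EQ Dn0 x3 y3; rewrite jqcoords_add EP EQ /jq_add_coords /= !mulr1.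
set D := 1 - _ in Dn0 x3 y3 *.
rewrite !xpair_eqE (sqrf_eq0 D) (negPf Dn0) !andbF /= sqrf_eq0 (negPf Dn0) /=.
by congr (_, _, _, _); rewrite /x3 /y3; field; exact: Dn0.
Qed.

Lemma jq_addC (P Q : jqpoint) : jq_add P Q = jq_add Q P.
Proof.
rewrite /jq_add; congr (insubd _ _).
case: (jqcoords P) (jqcoords Q) => [[[X1 Y1] T1] Z1] [[[X2 Y2] T2] Z2].
rewrite /jq_add_coords.
have -> : jq_law1 (X1, Y1, T1, Z1) (X2, Y2, T2, Z2)
        = jq_law1 (X2, Y2, T2, Z2) (X1, Y1, T1, Z1).
  by rewrite /=; congr (_, _, _, _); ring.
case: ifP => // _; congr jq_reduce.
by rewrite /=; congr (_, _, _, _); ring.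
Qed.

Lemma jq_add0 (P : jqpoint) : jq_add P jq0 = P.
Proof.
apply: val_inj; rewrite -![val _]/(jqcoords _) jqcoords_add /jq_add_coords.
have -> : jqcoords jq0 = (0, 1, 0, 1) by [].
have [[x [y ->]]|[s [se ->]]] := jq_reduced_shape P.
  have -> : jq_law1 (x, y, x ^+ 2, 1) (0, 1, 0, 1) = (x, y, x ^+ 2, 1).
    by rewrite /=; congr (_, _, _, _); ring.
  by rewrite !xpair_eqE oner_eq0 !andbF /= oner_eq0 /= !divr1.
have -> : jq_law1 (0, s, 1, 0) (0, 1, 0, 1) = (0, 0, 0, 0).
  by rewrite /=; congr (_, _, _, _); ring.
have -> : jq_law2 (0, s, 1, 0) (0, 1, 0, 1) = (0, s, 1, 0).
  by rewrite /=; congr (_, _, _, _); ring.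
by rewrite !eqxx /= eqxx /= !divr1.
Qed.

Lemma jq_addN (P : jqpoint) : jq_sub P P = jq0.
Proof.
apply: val_inj; rewrite -![val _]/(jqcoords _) jqcoords_add.
suff [c [-> cn0]] :
    exists c, jq_add_coords P (jq_opp P) = (0, c, 0, c) /\ c != 0.
  by rewrite /= cn0 !mul0r !divff.
have := @jq_laws_complete P (jq_opp P).
have := valP P => /= /andP[+ _].
rewrite /jq_add_coords /jq_opp /=.
case: (jqcoords P) => [[[X Y] T] Z] /andP[/eqP hX /eqP hY].
have -> : jq_law1 (X, Y, T, Z) (jq_opp_coords (X, Y, T, Z))
  = (0, (Z ^+ 2 - e * T ^+ 2) ^+ 2, 0, (Z ^+ 2 - e * T ^+ 2) ^+ 2).
  by rewrite /=; congr (_, _, _, _); ring: hX hY.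
have -> : jq_law2 (X, Y, T, Z) (jq_opp_coords (X, Y, T, Z))
  = (0, (2%:R * X * Y) ^+ 2, 0, (2%:R * X * Y) ^+ 2).
  by rewrite /=; congr (_, _, _, _); ring: hX hY.
case: eqP => [z /(_ z) n0|n0 _]; eexists; split; try by [].
  by apply: contra_not_neq n0 => ->.
by apply: contra_not_neq n0 => ->.
Qed.

End JacobiQuartic.

(* Main.v *)
Require Import Defs.
From mathcomp Require Import all_boot all_order all_algebra.
From mathcomp Require Import ring.

Import GRing.Theory.
Local Open Scope ring_scope.

(** Both formulas are homogeneous polynomial identities, once the two ways of
    computing a sum are used side by side.

    Write [N], [D] and [A], [B] for the numerators and denominators of the
    [x]-coordinate of [P1 + P2] in the two addition laws, that is
    [x3 = N / D = A / B].  Passing from [P1 + P2] to [P2 - P1] exchanges [N] and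
    [B] up to sign, keeps [A] and [D] up to sign, and [N B = A D] on the curve.
    Hence the product of the [X]-coordinates of [P1 + P2] and [P2 - P1] is
    [- N B] times [D^2], [A^2], [N^2] or [B^2], according to the laws chosen for
    the two points.  The product of the [Y]-coordinates is the same square times
    [- K], where [K = 4 (d^2 - e) X1^2 X2^2 - Y1^2 Y2^2].  This square cancels in
    the quotient, so
      [w3 w0 = 4 d^2 (N B)^2 / K^2]
    whichever laws compute the two points.  Dividing by the powers of [Y1] and
    [Y2] turns [2 d N B] into [w1 - w2] and [K] into
    [(1 - e / d^2) w1 w2 - 1], which the hypothesis on [w1 w2] makes nonzero.

    For the doubling, the first law at [P2 = P1] has [Y = - K] and
    [X = 2 X1 Y1 D], and on the curve
    [D^2 = (2 d X1^2 - Y1^2)^2 - 4 e X1^4] is a function of [w1] up to a power of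
    [Y1]. *)

(** A denominator-free form of [w = w(v)]: it makes sense for every vector of
    homogeneous coordinates, and holds trivially for the null one. *)
Definition w_relation {F : fieldType} (d w : F) (v : F * F * F * F) : Prop :=
  let: (X, Y, _, _) := v in w * Y ^+ 2 = 2%:R * d * X ^+ 2.

Lemma jq_w_relation {F : fieldType} {e d : F} {P : jqpoint e d} {w : F} :
  jq_w P = Some w -> w_relation d w P.
Proof.
rewrite /jq_w /w_relation; case: (jqcoords P) => [[[X Y] T] Z].
by case: eqP => // /eqP Yn0 [<-]; field.
Qed.

Lemma w_relation_scale {F : fieldType} {d w c X Y T Z : F} : c != 0 ->
  w_relation d w (X / c, Y / c, T / c, Z / c) -> w_relation d w (X, Y, T, Z).
Proof.
move=> cn0 /= h.
have -> : w * Y ^+ 2 = c ^+ 2 * (w * (Y / c) ^+ 2) by field.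
by rewrite h; field.
Qed.

Lemma w_relation_reduce {F : fieldType} {e d w : F} {v} :
  on_jquartic e d v -> v != (0, 0, 0, 0) ->
  w_relation d w (jq_reduce v) -> w_relation d w v.
Proof.
move=> onv vn0; have := jq_reduceP onv vn0; move: onv vn0.
case: v => [[[X Y] T] Z] _ _ /andP[_ red] /w_relation_scale; apply.
(* A zero divisor would make the reduced vector null. *)
apply: contraTneq red => c0.
by rewrite /= c0 invr0 !mulr0 eq_sym oner_eq0 andbF.
Qed.

(** Since the two laws are proportional, the law that is not used to compute the
    sum also satisfies the relation; it may be null. *)
Lemma jq_w_add {F : fieldType} {e d : F} (char2 : 2%N \notin [pchar F])
    (nonsing : e * (d ^+ 2 - e) != 0) {P Q : jqpoint e d} {w : F} :
  jq_w (jq_add P Q) = Some w ->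
  w_relation d w (jq_law1 e d P Q) /\ w_relation d w (jq_law2 e d P Q).
Proof.
move=> hw.
have Yn0 : let: (_, Y, _, _) := jqcoords (jq_add P Q) in Y != 0.
  move: hw; rewrite /jq_w; case: (jqcoords (jq_add P Q)) => [[[X Y] T] Z].
  by case: eqP.
move/jq_w_relation: hw Yn0; rewrite (jqcoords_add char2 nonsing) /jq_add_coords.
have /andP[onP _] := valP P; have /andP[onQ _] := valP Q.
have := jq_laws_agree onP onQ.
have := jq_law1_on onP onQ; have := jq_law2_on onP onQ.
have := @jq_laws_complete _ _ _ char2 nonsing P Q.
rewrite -![val _]/(jqcoords _).
case: (jq_law1 e d P Q) => [[[X3 Y3] T3] Z3].
case: (jq_law2 e d P Q) => [[[X4 Y4] T4] Z4].
move=> complete on4 on3 [XY _ _ _]; case: ifPn => [n0|/negbNE /eqP z].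
  move=> /(w_relation_reduce on3 n0) /= h3 Yc; split=> //.
  have Y3n0 : Y3 != 0 by apply: contraNneq Yc => ->; rewrite mul0r.
  have := expf_neq0 2 Y3n0 => /mulfI; apply.
  transitivity (w * Y3 ^+ 2 * Y4 ^+ 2); first by ring.
  rewrite h3; transitivity (2%:R * d * (X3 * Y4) ^+ 2); first by ring.
  by rewrite XY; ring.
have /eqP n4 := complete z.
move=> /(w_relation_reduce on4 n4) h4 _; split=> //.
by case: z => -> -> _ _ /=; rewrite !expr0n !mulr0.
Qed.

(** A common factor [s] of the products of the two [X]- and [Y]-coordinates
    cancels from the product of two values of [w]. *)
Lemma w_relation_mul {F : fieldType} {d w w' X Y T Z X' Y' T' Z' : F}
    (s a b : F) :
  w_relation d w (X, Y, T, Z) -> w_relation d w' (X', Y', T', Z') ->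
  X * X' = s * a -> Y * Y' = s * b -> s != 0 ->
  w * w' * b ^+ 2 = 4%:R * d ^+ 2 * a ^+ 2.
Proof.
move=> /= h h' XX YY sn0; have /mulfI := expf_neq0 2 sn0; apply.
transitivity (w * w' * (s * b) ^+ 2); first by ring.
rewrite -YY; transitivity (w * Y ^+ 2 * (w' * Y' ^+ 2)); first by ring.
rewrite h h'; transitivity (4%:R * d ^+ 2 * (X * X') ^+ 2); first by ring.
by rewrite XX; ring.
Qed.

Lemma on_jquartic_TZ_neq0 {F : fieldType} {e d X Y T Z : F} :
  on_jquartic e d (X, Y, T, Z) -> (X, Y, T, Z) <> (0, 0, 0, 0) ->
  (T != 0) || (Z != 0).
Proof.
move=> /= /andP[/eqP hX /eqP hY] n0; rewrite -negb_and.
apply/negP => /andP[/eqP T0 /eqP Z0]; apply: n0.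
have X0 : X = 0 by apply/eqP; rewrite -sqrf_eq0 hX T0 mul0r.
have Y0 : Y = 0.
  by apply/eqP; rewrite -sqrf_eq0 hY T0 X0 Z0 !expr0n !mulr0 !addr0.
by rewrite T0 Z0 X0 Y0.
Qed.

(** The product formula before dividing by the powers of [Y1] and [Y2].  Each of
    the four choices of laws for the two points gives it up to one of the factors
    [N ^+ 2], [D ^+ 2], [A ^+ 2], [B ^+ 2], and these do not all vanish because
    the two laws are never null together. *)
Lemma jq_w_add_sub {F : fieldType} {e d : F} (char2 : 2%N \notin [pchar F])
    (nonsing : e * (d ^+ 2 - e) != 0) {P1 P2 : jqpoint e d} {w0 w3 : F} :
  jq_w (jq_sub P2 P1) = Some w0 -> jq_w (jq_add P1 P2) = Some w3 ->
  let: (X1, Y1, _, _) := jqcoords P1 in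
  let: (X2, Y2, _, _) := jqcoords P2 in
  w3 * w0 * (4%:R * (d ^+ 2 - e) * X1 ^+ 2 * X2 ^+ 2 - Y1 ^+ 2 * Y2 ^+ 2) ^+ 2
  = 4%:R * d ^+ 2 * (X1 ^+ 2 * Y2 ^+ 2 - X2 ^+ 2 * Y1 ^+ 2) ^+ 2.
Proof.
move=> /(jq_w_add char2 nonsing) [h01 h02] /(jq_w_add char2 nonsing) [h31 h32].
have /andP[on1 _] := valP P1; have /andP[on2 _] := valP P2.
have on_law1 := jq_law1_on on1 on2; have on_law2 := jq_law2_on on1 on2.
have complete := @jq_laws_complete _ _ _ char2 nonsing P1 P2.
move: h01 h02 h31 h32 on1 on2 on_law1 on_law2 complete.
rewrite -![val _]/(jqcoords _).
rewrite [jqcoords (jq_opp P1)]/(jq_opp_coords P1).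
case: (jqcoords P1) => [[[X1 Y1] T1] Z1]; case: (jqcoords P2) => [[[X2 Y2] T2] Z2].
move=> h01 h02 h31 h32 /andP[/eqP hX1 /eqP hY1] /andP[/eqP hX2 /eqP hY2].
move=> /on_jquartic_TZ_neq0 ND /on_jquartic_TZ_neq0 AB complete.
set K := _ - Y1 ^+ 2 * Y2 ^+ 2; set P := X1 ^+ 2 * Y2 ^+ 2 - _.
(* For each choice of laws both products are a square times [- P] or [- K]. *)
rewrite -[K ^+ 2]sqrrN -[P ^+ 2]sqrrN.
have [law1_0|/eqP /ND] :=
  eqVneq (jq_law1 e d (X1, Y1, T1, Z1) (X2, Y2, T2, Z2)) (0, 0, 0, 0).
  have /AB := complete law1_0.
  rewrite !sqrf_eq0 => /orP[A0|B0].
    apply: (w_relation_mul _ _ _ h32 h02 _ _ (expf_neq0 2 A0)).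
      by rewrite /P; ring: hX1 hY1 hX2 hY2.
    by rewrite /K; ring: hX1 hY1 hX2 hY2.
  apply: (w_relation_mul _ _ _ h32 h01 _ _ (expf_neq0 2 B0)).
    by rewrite /P; ring: hX1 hY1 hX2 hY2.
  by rewrite /K; ring: hX1 hY1 hX2 hY2.
rewrite !sqrf_eq0 => /orP[N0|D0].
  apply: (w_relation_mul _ _ _ h31 h02 _ _ (expf_neq0 2 N0)).
    by rewrite /P; ring: hX1 hY1 hX2 hY2.
  by rewrite /K; ring: hX1 hY1 hX2 hY2.
apply: (w_relation_mul _ _ _ h31 h01 _ _ (expf_neq0 2 D0)).
  by rewrite /P; ring: hX1 hY1 hX2 hY2.
by rewrite /K; ring: hX1 hY1 hX2 hY2.
Qed.

(** At equal arguments the first law has [Y = - K], which is why the denominators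
    of the doubling and of the product formula have the same shape. *)
Lemma jq_w_double {F : fieldType} {e d : F} (char2 : 2%N \notin [pchar F])
    (nonsing : e * (d ^+ 2 - e) != 0) {P : jqpoint e d} {w : F} :
  jq_w (jq_double P) = Some w ->
  let: (X, Y, _, _) := jqcoords P in
  w * (4%:R * (d ^+ 2 - e) * X ^+ 2 * X ^+ 2 - Y ^+ 2 * Y ^+ 2) ^+ 2
  = 8%:R * d * X ^+ 2 * Y ^+ 2
    * ((2%:R * d * X ^+ 2 - Y ^+ 2) ^+ 2 - 4%:R * e * (X ^+ 2) ^+ 2).
Proof.
move=> /(jq_w_add char2 nonsing) [+ _]; have /andP[+ _] := valP P.
rewrite -![val _]/(jqcoords _); case: (jqcoords P) => [[[X Y] T] Z] /=.
move=> /andP[/eqP hX /eqP hY] h.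
set M := _ + 2%:R * e * X * X * _ in h.
set K := _ - Y ^+ 2 * Y ^+ 2.
have -> : K = - M by rewrite /K /M; ring: hX hY.
by rewrite sqrrN h; ring: hX hY.
Qed.

(** Since [d ^+ 2 - e] is invertible, the excluded value of [w1 * w2] is the only
    zero of the common denominator. *)
Lemma w_denom_neq0 {F : fieldType} {e d : F} (nonsing : e * (d ^+ 2 - e) != 0)
    (d_neq0 : d != 0) {w1 w2 : F} :
  w1 * w2 != d ^+ 2 / (d ^+ 2 - e) -> (1 - e / d ^+ 2) * w1 * w2 - 1 != 0.
Proof.
move: nonsing; rewrite mulf_eq0 negb_or => /andP[_ den0].
apply: contra_neq => /subr0_eq h; apply: (mulIf den0).
rewrite divfK // -[RHS]mulr1 -h; by field.
Qed.

Theorem proposition5 (F : finFieldType) (e d : F)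
  (odd_char : 2%N \notin [pchar F])
  (nonsing : e * (d ^+ 2 - e) != 0) (d_neq0 : d != 0)
  (P1 P2 : jqpoint e d) (w0 w1 w2 w3 w4 : F)
  (hw0 : jq_w (jq_sub P2 P1) = Some w0)
  (hw1 : jq_w P1 = Some w1)
  (hw2 : jq_w P2 = Some w2)
  (hw3 : jq_w (jq_add P1 P2) = Some w3)
  (hw4 : jq_w (jq_double P1) = Some w4)
  (hw12 : w1 * w2 != d ^+ 2 / (d ^+ 2 - e))
  (hw11 : w1 ^+ 2 != d ^+ 2 / (d ^+ 2 - e)) :
  w4 = 4%:R * w1 * ((w1 - 1) ^+ 2 - e / d ^+ 2 * w1 ^+ 2)
       / ((1 - e / d ^+ 2) * w1 ^+ 2 - 1) ^+ 2
  /\ w3 * w0 = (w1 - w2) ^+ 2 / ((1 - e / d ^+ 2) * w1 * w2 - 1) ^+ 2.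
Proof.
have k11 : (1 - e / d ^+ 2) * w1 ^+ 2 - 1 != 0.
  by rewrite expr2 mulrA; apply: w_denom_neq0.
have k12 := w_denom_neq0 nonsing d_neq0 hw12.
have {hw4} := jq_w_double odd_char nonsing hw4.
have {hw0 hw3} := jq_w_add_sub odd_char nonsing hw0 hw3.
move: hw1 hw2; rewrite /jq_w.
case: (jqcoords P1) => [[[X1 Y1] T1] Z1]; case: (jqcoords P2) => [[[X2 Y2] T2] Z2].
case: eqP => // /eqP Y1n0 [w1E]; case: eqP => // /eqP Y2n0 [w2E] h30 h4.
have h1 : 2%:R * d * X1 ^+ 2 = w1 * Y1 ^+ 2 by rewrite -w1E; field.
have h2 : 2%:R * d * X2 ^+ 2 = w2 * Y2 ^+ 2 by rewrite -w2E; field.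
split.
  have /mulIf := expf_neq0 2 k11; apply; rewrite divfK ?expf_neq0 //.
  have /mulIf := expf_neq0 8 Y1n0; apply.
  transitivity (w4 * ((1 - e / d ^+ 2) * (w1 * Y1 ^+ 2) ^+ 2 - Y1 ^+ 4) ^+ 2).
    by ring.
  (* Up to the power of [Y1], this is [K] written in terms of [w1]. *)
  rewrite -h1; transitivity
    (w4 * (4%:R * (d ^+ 2 - e) * X1 ^+ 2 * X1 ^+ 2 - Y1 ^+ 2 * Y1 ^+ 2) ^+ 2).
    by field.
  rewrite h4; transitivity (4%:R * (w1 * Y1 ^+ 2) * Y1 ^+ 2 *
    ((w1 * Y1 ^+ 2 - Y1 ^+ 2) ^+ 2 - e / d ^+ 2 * (w1 * Y1 ^+ 2) ^+ 2)).
    by rewrite -h1; field.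
  by ring.
have /mulIf := expf_neq0 2 k12; apply; rewrite divfK ?expf_neq0 //.
have /mulIf := expf_neq0 4 (mulf_neq0 Y1n0 Y2n0); apply.
transitivity (w3 * w0 * ((1 - e / d ^+ 2) * (w1 * Y1 ^+ 2) * (w2 * Y2 ^+ 2)
                         - Y1 ^+ 2 * Y2 ^+ 2) ^+ 2); first by ring.
rewrite -h1 -h2; transitivity (w3 * w0 *
  (4%:R * (d ^+ 2 - e) * X1 ^+ 2 * X2 ^+ 2 - Y1 ^+ 2 * Y2 ^+ 2) ^+ 2).
  by field.
rewrite h30; transitivity
  ((w1 * Y1 ^+ 2 * Y2 ^+ 2 - w2 * Y2 ^+ 2 * Y1 ^+ 2) ^+ 2).
  by rewrite -h1 -h2; ring.
by ring.
Qed.
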